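(* Let $X$ be a pointed metric space and $E$ a Banach space over $\mathbb{K}$. The map $I\colon X\boxtimes_{\pi} E\to \mathcal{F}(X)\otimes_\pi E$, defined by $$I(u)=\sum_{i=1}^n(\delta_{x_i}-\delta_{y_i})\otimes e_i$$ for $u=\sum_{i=1}^n \delta_{(x_i,y_i)}\boxtimes e_i\in X\boxtimes E$, is a (well-defined) linear isometry. Moreover, $X\widehat{\boxtimes}_{\pi} E$ is isometrically isomorphic to $\mathcal{F}(X)\widehat{\otimes}_\pi E$.
   Context: $\mathbb{K}$ is $\mathbb{R}$ or $\mathbb{C}$. A pointed metric space $X$ is a metric space (with metric $d$) with a distinguished base point $0$. For a pointed metric space $X$ and a Banach space $F$, $\mathrm{Lip}_0(X,F)$ is the Banach space of all Lipschitz maps $f\colon X\to F$ with $f(0)=0$, normed by the least Lipschitz constant $\mathrm{Lip}(f)$; $X^\#=\mathrm{Lip}_0(X,\mathbb{K})$. $E^*$ is the topological dual of $E$ and $\langle\phi,e\rangle=\phi(e)$; $V'$ denotes the algebraic dual of a vector space $V$. For $x,y\in X$ and $e\in E$, $\delta_{(x,y)}\boxtimes e\in \mathrm{Lip}_0(X,E^* )'$ is the linear functional $f\mapsto\langle f(x)-f(y),e\rangle$. The Lipschitz tensor product $X\boxtimes E$ is the linear subspace of $\mathrm{Lip}_0(X,E^* )'$ spanned by all the functionals $\delta_{(x,y)}\boxtimes e$ with $x,y\in X$, $e\in E$. Every $u\in X\boxtimes E$ can be written (non-uniquely) as $u=\sum_{i=1}^n\delta_{(x_i,y_i)}\boxtimes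 e_i$. For $u\in X\boxtimes E$, the Lipschitz projective norm is $$\pi(u)=\inf\left\{\sum_{i=1}^n d(x_i,y_i)\|e_i\|\colon u=\sum_{i=1}^n\delta_{(x_i,y_i)}\boxtimes e_i\right\},$$ the infimum being over all representations of $u$. $X\boxtimes_\pi E$ is $X\boxtimes E$ with the norm $\pi$, and $X\widehat{\boxtimes}_{\pi}E$ is its completion. The Lipschitz-free space $\mathcal{F}(X)$ is the closed linear subspace of $(X^\#)^*$ spanned by $\{\delta_x\colon x\in X\}$, where $\delta_x(g)=g(x)$ for $g\in X^\#$. $\mathcal{F}(X)\otimes_\pi E$ is the algebraic tensor product of the Banach spaces $\mathcal{F}(X)$ and $E$ with the usual projective tensor norm, and $\mathcal{F}(X)\widehat{\otimes}_\pi E$ is its completion. *)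

(* Defs.v *)
From HB Require Import structures.
From mathcomp Require Import all_boot all_order all_algebra.
From mathcomp Require Import sesquilinear complex.
From mathcomp Require Import all_classical all_reals all_analysis.

Set Implicit Arguments.
Unset Strict Implicit.
Unset Printing Implicit Defensive.
Import Order.TTheory GRing.Theory Num.Theory.
Import numFieldNormedType.Exports.
Local Open Scope classical_set_scope.
Local Open Scope ring_scope.

Inductive scalars := Reals | Complexes.

Definition scalar_field (R : realType) (s : scalars) : numFieldType :=
  match s with Reals => R | Complexes => R[i] end.

Section ScalarField.
Variables (R : realType) (s : scalars).
Local Notation K := (scalar_field R s).

Definition of_real : R -> K :=
  match s return R -> scalar_field R s with
  | Reals => fun x => x
  | Complexes => fun x => x%:C%C
  end.

Definition to_real : K -> R :=
  match s return scalar_field R s -> R with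
  | Reals => fun x => x
  | Complexes => fun z => complex.Re z
  end.

Lemma of_realK : cancel of_real to_real.
Proof. by rewrite /of_real /to_real; case: s. Qed.

Lemma to_realK (k : K) : 0 <= k -> of_real (to_real k) = k.
Proof.
rewrite /of_real /to_real; case: s k => //= -[a b].
by rewrite lecE /= => /andP[/eqP-> _].
Qed.

Lemma of_realD x y : of_real (x + y) = of_real x + of_real y.
Proof. by rewrite /of_real; case: s => //=; rewrite rmorphD. Qed.

Lemma of_realM x y : of_real (x * y) = of_real x * of_real y.
Proof. by rewrite /of_real; case: s => //=; rewrite rmorphM. Qed.

Lemma of_realV x : of_real x^-1 = (of_real x)^-1.
Proof. by rewrite /of_real; case: s => //=; rewrite fmorphV. Qed.

Lemma of_real0 : of_real 0 = 0.
Proof. by rewrite /of_real; case: s. Qed.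

Lemma ler_of_real x y : (of_real x <= of_real y) = (x <= y).
Proof. by rewrite /of_real; case: s => //=; rewrite lecR. Qed.

(* In a normedModType over K the norm takes values in K itself. *)
Definition rnorm (E : normedModType K) (e : E) : R := to_real `|e|.

Section RealNorm.
Variable E : normedModType K.
Implicit Types e f : E.

Lemma of_rnorm e : of_real (rnorm e) = `|e|.
Proof. exact/to_realK. Qed.

Lemma rnorm_ge0 e : 0 <= rnorm e.
Proof. by rewrite -ler_of_real of_real0 of_rnorm. Qed.

Lemma rnormD e f : rnorm (e + f) <= rnorm e + rnorm f.
Proof. by rewrite -ler_of_real of_realD !of_rnorm ler_normD. Qed.

Lemma rnorm0 : rnorm (0 : E) = 0.
Proof. by rewrite /rnorm normr0 -of_real0 of_realK. Qed.

Lemma rnorm_eq0 e : rnorm e = 0 -> e = 0.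
Proof. by move=> e0; apply/normr0_eq0; rewrite -of_rnorm e0 of_real0. Qed.

End RealNorm.

Lemma rnormZ (E : normedModType K) (a : K) (e : E) :
  rnorm (a *: e) = rnorm (a : K^o) * rnorm e.
Proof.
by apply: (can_inj of_realK); rewrite of_realM !of_rnorm normrZ.
Qed.

End ScalarField.

Lemma homogeneous_le (R : realType) (s : scalars)
    (V : lmodType (scalar_field R s)) (N : V -> R) :
  (forall v, 0 <= N v) ->
  (forall a v, N (a *: v) <= rnorm (a : (scalar_field R s)^o) * N v) ->
  forall a v, N (a *: v) = rnorm (a : (scalar_field R s)^o) * N v.
Proof.
move=> N0 Nle a v; apply/eqP; rewrite eq_le Nle/=.
have [->|a0] := eqVneq a 0; first by rewrite rnorm0 mul0r N0.
have := Nle a^-1 (a *: v); rewrite scalerA mulVf// scale1r.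
move=> /(ler_wpM2l (rnorm_ge0 (a : (scalar_field R s)^o))).
have -> : rnorm (a^-1 : (scalar_field R s)^o)
        = (rnorm (a : (scalar_field R s)^o))^-1.
  by apply: (can_inj (@of_realK R s)); rewrite of_realV !of_rnorm normfV.
rewrite mulrA mulfV ?mul1r//.
by apply: contra_neq a0 => /rnorm_eq0.
Qed.

(* Common shape of the operator norm and of the least Lipschitz constant; by
   least_constantP the infimum is attained in both cases. *)
Section LeastConstant.
Variables (R : realType) (I : Type).
Implicit Types a b : I -> R.

Definition constants a b : set R :=
  [set C | 0 <= C /\ forall i, a i <= C * b i].

Definition least_constant a b : R := inf (constants a b).

Lemma least_constant_ge0 a b :
  constants a b !=set0 -> 0 <= least_constant a b.
Proof. by move=> ne; apply: lb_le_inf => // C []. Qed.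

Lemma least_constant_le a b C :
  constants a b C -> least_constant a b <= C.
Proof. by move=> aC; apply: ge_inf => //; exists 0 => D []. Qed.

Lemma least_constantP a b (b0 : forall i, 0 <= b i) :
  constants a b !=set0 -> forall i, a i <= least_constant a b * b i.
Proof.
move=> ne i; have := b0 i; rewrite le_eqVlt => /predU1P[bi0|bi0].
  by have [C [_ /(_ i)]] := ne; rewrite -bi0 !mulr0.
rewrite -ler_pdivrMr//; apply: lb_le_inf => // C [_ /(_ i)].
by rewrite ler_pdivrMr.
Qed.

End LeastConstant.

Section AlgebraicDual.
Variables (K : numFieldType) (V : lmodType K).

Lemma linear_form0 : linear (0 : V -> K^o).
Proof. by move=> b u v; transitivity (b *: (0 : K^o) + 0); rewrite ?scaler0 ?addr0. Qed.

Lemma linear_formD (a : K) (f g : V -> K^o) :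
  linear f -> linear g -> linear (a *: f + g : V -> K^o).
Proof.
move=> lf lg b u v.
transitivity (a *: f (b *: u + v) + g (b *: u + v)) => //.
transitivity (b *: (a *: f u + g u) + (a *: f v + g v)) => //.
by rewrite lf lg !scalerDr !scalerA mulrC addrACA.
Qed.

Definition is_linear_form : {pred V -> K^o} := fun f => `[< linear f >].

Fact is_linear_form_submod : submod_closed is_linear_form.
Proof.
split=> [|a f g /asboolP lf /asboolP lg]; apply/asboolP.
  exact: linear_form0.
exact: linear_formD.
Qed.
HB.instance Definition _ :=
  GRing.isSubmodClosed.Build K (V -> K^o) is_linear_form is_linear_form_submod.

Record alg_dual := AlgDual
  { alg_dual_fun :> V -> K^o ; _ : alg_dual_fun \in is_linear_form }.

HB.instance Definition _ := [isSub for alg_dual_fun].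
HB.instance Definition _ := [Choice of alg_dual by <:].
HB.instance Definition _ := [SubChoice_isSubLmodule of alg_dual by <:].

End AlgebraicDual.

Section Span.
Variables (K : numFieldType) (V : lmodType K) (S : set V).

Definition in_span : {pred V} := fun v =>
  `[< exists n (a : 'I_n -> K) (w : 'I_n -> V),
        (forall i, S (w i)) /\ v = \sum_i a i *: w i >].

Fact in_span_submod : submod_closed in_span.
Proof.
split=> [|c u v /asboolP[n [a [w [Sw ->]]]] /asboolP[m [b [z [Sz ->]]]]].
  by apply/asboolP; exists 0%N, (fun=> 0), (fun=> 0); split=> [[]//|]; rewrite big_ord0.
apply/asboolP; exists (n + m)%N,
  (fun i => match fintype.split i with inl j => c * a j | inr j => b j end),
  (fun i => match fintype.split i with inl j => w j | inr j => z j end).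
split=> [i|]; first by case: (fintype.split i).
rewrite big_split_ord scaler_sumr; congr (_ + _); apply: eq_bigr => i _.
  by rewrite (unsplitK (inl i)) scalerA.
by rewrite (unsplitK (inr i)).
Qed.
HB.instance Definition _ :=
  GRing.isSubmodClosed.Build K V in_span in_span_submod.

Record span := Span { span_val : V ; _ : span_val \in in_span }.

HB.instance Definition _ := [isSub for span_val].
HB.instance Definition _ := [Choice of span by <:].
HB.instance Definition _ := [SubChoice_isSubLmodule of span by <:].

Lemma mem_in_span v : S v -> v \in in_span.
Proof.
move=> Sv; apply/asboolP; exists 1%N, (fun=> 1), (fun=> v); split=> //.
by rewrite big_ord1 scale1r.
Qed.

Definition span_gen v (Sv : S v) : span := Span (mem_in_span Sv).

End Span.

(* The algebraic tensor product of V and W is realised, as is usual in the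
   theory of tensor products of Banach spaces, as the linear span of the
   evaluations B |-> B v w among the functionals on the space of all (not
   necessarily bounded) bilinear forms on V x W. *)
Section TensorProduct.
Variables (K : numFieldType) (V W : lmodType K).

Definition eval_bilin (v : V) (w : W) : {bilinear V -> W -> K^o} -> K^o :=
  fun B => B v w.

Definition tensor_product := span [set eval_bilin p.1 p.2 | p in [set: V * W]].

HB.instance Definition _ := GRing.SubLmodule.on tensor_product.

Definition tens (v : V) (w : W) : tensor_product :=
  span_gen (imageP (fun p => eval_bilin p.1 p.2) (I : [set: V * W] (v, w))).

End TensorProduct.

Section TopologicalDual.
Variables (R : realType) (s : scalars).
Local Notation K := (scalar_field R s).
Variable E : normedModType K.

Definition is_continuous_form : {pred E -> K^o} :=
  fun f => `[< linear f /\ continuous f >].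

Fact is_continuous_form_submod : submod_closed is_continuous_form.
Proof.
split=> [|a f g /asboolP[lf cf] /asboolP[lg cg]]; apply/asboolP; split.
- exact: linear_form0.
- by move=> x; apply: cst_continuous.
- exact: linear_formD.
- by move=> x; apply: cvgD; [apply: cvgZr; apply: cf|apply: cg].
Qed.
HB.instance Definition _ := GRing.isSubmodClosed.Build K (E -> K^o)
  is_continuous_form is_continuous_form_submod.

Record dual := Dual
  { dual_fun :> E -> K^o ; _ : dual_fun \in is_continuous_form }.

HB.instance Definition _ := [isSub for dual_fun].
HB.instance Definition _ := [Choice of dual by <:].
HB.instance Definition _ := [SubChoice_isSubLmodule of dual by <:].

Implicit Types phi psi : dual.

Lemma dualE :
  (forall phi psi e, (phi + psi) e = phi e + psi e) *
  (forall phi e, (- phi) e = - phi e) *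
  (forall (a : K) phi e, (a *: phi) e = a *: phi e).
Proof. by []. Qed.

Definition dual_norm phi : R :=
  least_constant (fun e => rnorm (phi e)) (fun e => rnorm e).

Lemma dual_linear phi : linear phi.
Proof. by case: phi => f /= /asboolP[]. Qed.

Lemma dual_continuous phi : continuous phi.
Proof. by case: phi => f /= /asboolP[]. Qed.

Lemma dual_bounded phi :
  constants (fun e => rnorm (phi e)) (fun e : E => rnorm e) !=set0.
Proof.
pose lphi : {linear E -> K^o} :=
  HB.pack (phi : E -> K^o) (GRing.isLinear.Build _ _ _ _ phi (dual_linear phi)).
have [k k0 kP] := @linear_lipschitz _ _ _ lphi (@dual_continuous phi).
exists (to_real k); split=> [|e].
  by rewrite -(ler_of_real s) of_real0 to_realK ltW.
by rewrite -(ler_of_real s) of_realM to_realK ?(ltW k0)// !of_rnorm kP.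
Qed.

Lemma dual_normP phi e : rnorm (phi e) <= dual_norm phi * rnorm e.
Proof.
exact: (least_constantP (fun e => rnorm_ge0 e) (dual_bounded phi) e).
Qed.

Lemma dual_norm_ge0 phi : 0 <= dual_norm phi.
Proof. exact/least_constant_ge0/dual_bounded. Qed.

Lemma dual_normD phi psi :
  dual_norm (phi + psi) <= dual_norm phi + dual_norm psi.
Proof.
apply: least_constant_le; split=> [|e]; first by rewrite addr_ge0 ?dual_norm_ge0.
by rewrite mulrDl (le_trans (rnormD _ _))// lerD ?dual_normP.
Qed.

Lemma dual_norm_eq0 phi : dual_norm phi = 0 -> phi = 0.
Proof.
move=> phi0; apply/val_inj/funext => e /=; apply: rnorm_eq0; apply/eqP.
by rewrite eq_le rnorm_ge0 andbT -(mul0r (rnorm e)) -phi0 dual_normP.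
Qed.

Let dual_normZ_le (a : K) phi :
  dual_norm (a *: phi) <= rnorm (a : K^o) * dual_norm phi.
Proof.
apply: least_constant_le; split=> [|e].
  by rewrite mulr_ge0 ?rnorm_ge0 ?dual_norm_ge0.
have -> : (a *: phi) e = a *: phi e by [].
by rewrite rnormZ -mulrA ler_wpM2l ?rnorm_ge0 ?dual_normP.
Qed.

Lemma dual_normZ (a : K) phi :
  dual_norm (a *: phi) = rnorm (a : K^o) * dual_norm phi.
Proof. exact: homogeneous_le dual_norm_ge0 dual_normZ_le a phi. Qed.

Let dual_knormD phi psi : of_real s (dual_norm (phi + psi)) <=
  of_real s (dual_norm phi) + of_real s (dual_norm psi).
Proof. by rewrite -of_realD ler_of_real dual_normD. Qed.

Let dual_knormZ (a : K) phi :
  of_real s (dual_norm (a *: phi)) = `|a| * of_real s (dual_norm phi).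
Proof. by rewrite dual_normZ of_realM of_rnorm. Qed.

Let dual_knorm_eq0 phi : of_real s (dual_norm phi) = 0 -> phi = 0.
Proof. by rewrite -(of_real0 R s) => /(can_inj (@of_realK R s))/dual_norm_eq0. Qed.

HB.instance Definition _ := Lmodule_isNormed.Build K dual
  dual_knormD dual_knormZ dual_knorm_eq0.

Lemma rnorm_dualE phi : rnorm phi = dual_norm phi.
Proof. exact: of_realK. Qed.

End TopologicalDual.

Section Lipschitz0.
Variables (R : realType) (s : scalars).
Local Notation K := (scalar_field R s).
Variables (X : metricType R) (x0 : X) (F : normedModType K).

Definition is_lip0 : {pred X -> F} := fun f =>
  `[< f x0 = 0 /\
      exists C : R, forall x y, rnorm (f x - f y) <= C * mdist x y >].

Fact is_lip0_submod : submod_closed is_lip0.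
Proof.
split=> [|a f g /asboolP[f0 [C fC]] /asboolP[g0 [D gD]]]; apply/asboolP; split.
- by [].
- by exists 0 => x y; rewrite (_ : _ - _ = 0) ?rnorm0 ?mul0r//; apply: subrr.
- by transitivity (a *: f x0 + g x0); rewrite // f0 g0 scaler0 addr0.
- exists (rnorm (a : K^o) * C + D) => x y.
  have -> : (a *: f + g) x - (a *: f + g) y = a *: (f x - f y) + (g x - g y).
    transitivity (a *: f x + g x - (a *: f y + g y)) => //.
    by rewrite scalerBr opprD addrACA.
  rewrite (le_trans (rnormD _ _))// mulrDl lerD ?gD//.
  by rewrite rnormZ -mulrA ler_wpM2l ?rnorm_ge0.
Qed.
HB.instance Definition _ :=
  GRing.isSubmodClosed.Build K (X -> F) is_lip0 is_lip0_submod.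

Record lip0 := Lip0 { lip0_fun :> X -> F ; _ : lip0_fun \in is_lip0 }.

HB.instance Definition _ := [isSub for lip0_fun].
HB.instance Definition _ := [Choice of lip0 by <:].
HB.instance Definition _ := [SubChoice_isSubLmodule of lip0 by <:].

Implicit Types f g : lip0.

Lemma lip0E :
  (forall f g x, (f + g) x = f x + g x) *
  (forall f x, (- f) x = - f x) *
  (forall (a : K) f x, (a *: f) x = a *: f x).
Proof. by []. Qed.

Definition lip f : R :=
  least_constant (fun p : X * X => rnorm (f p.1 - f p.2))
                 (fun p => mdist p.1 p.2).

Lemma lip0_base f : f x0 = 0.
Proof. by case: f => f /= /asboolP[]. Qed.

Lemma lip0_bounded f :
  constants (fun p : X * X => rnorm (f p.1 - f p.2))
            (fun p => mdist p.1 p.2) !=set0.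
Proof.
case: f => f /= /asboolP[_ [C fC]].
exists `|C|; split=> // -[x y] /=; rewrite (le_trans (fC x y))//.
by rewrite ler_wpM2r ?mdist_ge0 ?ler_norm.
Qed.

Lemma lipP f x y : rnorm (f x - f y) <= lip f * mdist x y.
Proof.
exact: (least_constantP (fun p => mdist_ge0 p.1 p.2) (lip0_bounded f) (x, y)).
Qed.

Lemma lip_ge0 f : 0 <= lip f.
Proof. exact/least_constant_ge0/lip0_bounded. Qed.

Lemma lipD f g : lip (f + g) <= lip f + lip g.
Proof.
apply: least_constant_le; split=> [|[x y] /=]; first by rewrite addr_ge0 ?lip_ge0.
have -> : (f + g) x - (f + g) y = (f x - f y) + (g x - g y).
  by transitivity (f x + g x - (f y + g y)); rewrite // opprD addrACA.
by rewrite mulrDl (le_trans (rnormD _ _))// lerD ?lipP.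
Qed.

Lemma lip_eq0 f : lip f = 0 -> f = 0.
Proof.
move=> f0; apply/val_inj/funext => x /=.
transitivity (f x - f x0); first by rewrite lip0_base subr0.
apply: rnorm_eq0; apply/eqP.
by rewrite eq_le rnorm_ge0 andbT -(mul0r (mdist x x0)) -f0 lipP.
Qed.

Let lipZ_le (a : K) f : lip (a *: f) <= rnorm (a : K^o) * lip f.
Proof.
apply: least_constant_le; split=> [|[x y] /=].
  by rewrite mulr_ge0 ?rnorm_ge0 ?lip_ge0.
have -> : (a *: f) x - (a *: f) y = a *: (f x - f y) by rewrite scalerBr.
by rewrite rnormZ -mulrA ler_wpM2l ?rnorm_ge0 ?lipP.
Qed.

Lemma lipZ (a : K) f : lip (a *: f) = rnorm (a : K^o) * lip f.
Proof. exact: homogeneous_le lip_ge0 lipZ_le a f. Qed.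

Let lip_knormD f g :
  of_real s (lip (f + g)) <= of_real s (lip f) + of_real s (lip g).
Proof. by rewrite -of_realD ler_of_real lipD. Qed.

Let lip_knormZ (a : K) f : of_real s (lip (a *: f)) = `|a| * of_real s (lip f).
Proof. by rewrite lipZ of_realM of_rnorm. Qed.

Let lip_knorm_eq0 f : of_real s (lip f) = 0 -> f = 0.
Proof. by rewrite -(of_real0 R s) => /(can_inj (@of_realK R s))/lip_eq0. Qed.

HB.instance Definition _ := Lmodule_isNormed.Build K lip0
  lip_knormD lip_knormZ lip_knorm_eq0.

Lemma rnorm_lip0E f : rnorm f = lip f.
Proof. exact: of_realK. Qed.

End Lipschitz0.

Section FreeSpace.
Variables (R : realType) (s : scalars) (X : metricType R) (x0 : X).
Local Notation K := (scalar_field R s).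

(* X^# *)
Local Notation lip_dual := (lip0 x0 K^o).

Fact eval_continuous x :
  (fun g : lip_dual => g x) \in is_continuous_form (E := lip_dual).
Proof.
apply/asboolP; split=> // g.
apply/(cvgrPdist_le (FF := nbhs_filter g)) => e e0.
pose k : K := of_real s (mdist x x0).
have k0 : 0 <= k by rewrite -(of_real0 R s) ler_of_real mdist_ge0.
have k1 : 0 < k + 1 by rewrite ltr_wpDl.
have ek : 0 < e / (k + 1) by rewrite divr_gt0.
near=> h.
have gh : `|g - h| <= e / (k + 1) by near: h; exact: cvgr_dist_le.
have -> : g x - h x = (g - h) x - (g - h) x0.
  by rewrite [(g - h) x0]lip0_base subr0.
rewrite -of_rnorm (le_trans (y := `|g - h| * k))//.
  by rewrite -[`|g - h|]of_rnorm -of_realM ler_of_real rnorm_lip0E lipP.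
rewrite (le_trans (ler_wpM2r k0 gh))// mulrAC ler_pdivrMr//.
by rewrite ler_pM2l// lerDl.
Unshelve. all: by end_near. Qed.

Definition delta x : dual lip_dual := Dual (eval_continuous x).

Definition in_free : {pred dual lip_dual} :=
  fun m => `[< closure [set` in_span (range delta)] m >].

Fact in_freeP m : reflect
  (forall e : K, 0 < e -> exists2 v, v \in in_span (range delta) & `|m - v| < e)
  (m \in in_free).
Proof.
apply: (iffP (asboolP _)) => [cm e e0|cm B /nbhs_ballP[e /= e0 eB]].
  have [v [/= vS]] := cm _ (nbhsx_ballx m e e0).
  by rewrite -ball_normE /= => mv; exists v.
have [v vS mv] := cm e e0; exists v; split=> //.
by apply: eB; rewrite -ball_normE.
Qed.

Fact in_free_submod : submod_closed in_free.
Proof.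
split=> [|a u v /in_freeP uS /in_freeP vS]; apply/in_freeP => e e0.
  by exists 0; rewrite ?rpred0// subrr normr0.
have a0 : 0 < `|a| + 1 by rewrite ltr_wpDl.
have [u' u'S uu'] := uS (e / 2 / (`|a| + 1)) (divr_gt0 (divr_gt0 e0 (ltr0Sn K 1)) a0).
have [v' v'S vv'] := vS (e / 2) (divr_gt0 e0 (ltr0Sn K 1)).
exists (a *: u' + v'); first by rewrite rpredD ?rpredZ.
rewrite opprD addrACA -scalerBr (le_lt_trans (ler_normD _ _))//.
rewrite [ltRHS]splitr ler_ltD// normrZ.
rewrite (le_trans (ler_wpM2l (normr_ge0 a) (ltW uu')))//.
by rewrite mulrCA ger_pMr ?divr_gt0// ler_pdivrMr// mul1r lerDl.
Qed.
HB.instance Definition _ :=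
  GRing.isSubmodClosed.Build K (dual lip_dual) in_free in_free_submod.

Record free_space := FreeSpace
  { free_val : dual lip_dual ; _ : free_val \in in_free }.

HB.instance Definition _ := [isSub for free_val].
HB.instance Definition _ := [Choice of free_space by <:].
HB.instance Definition _ := [SubChoice_isSubLmodule of free_space by <:].

Let free_normD (m n : free_space) :
  `|free_val (m + n)| <= `|free_val m| + `|free_val n|.
Proof. exact: ler_normD. Qed.

Let free_normZ (a : K) (m : free_space) :
  `|free_val (a *: m)| = `|a| * `|free_val m|.
Proof. exact: normrZ. Qed.

Let free_norm_eq0 (m : free_space) : `|free_val m| = 0 -> m = 0.
Proof. by move=> /normr0_eq0 m0; apply: val_inj. Qed.

HB.instance Definition _ := Lmodule_isNormed.Build K free_space
  free_normD free_normZ free_norm_eq0.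

Lemma normr_freeE (m : free_space) : `|m| = `|free_val m|.
Proof. by []. Qed.

Fact delta_in_free x : delta x \in in_free.
Proof.
by apply/asboolP/subset_closure; apply: mem_in_span; exists x.
Qed.

Definition free_delta x : free_space := FreeSpace (delta_in_free x).

End FreeSpace.

Section LipschitzTensorProduct.
Variables (R : realType) (s : scalars) (X : metricType R) (x0 : X).
Local Notation K := (scalar_field R s).
Variable E : normedModType K.

Fact eval_box_linear x y e :
  (fun f : lip0 x0 (dual E) => (f x - f y : dual E) e) \in
    is_linear_form (V := lip0 x0 (dual E)).
Proof.
apply/asboolP => a f g; rewrite !lip0E; set u := f x; set v := f y.
by rewrite !dualE scalerBr opprD addrACA.
Qed.

(* eval_box x y e and box x y e are both delta_(x,y) \boxtimes e, seen in the
   algebraic dual of Lip_0(X, E^* ) and in the Lipschitz tensor product. *)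
Definition eval_box (x y : X) (e : E) : alg_dual (lip0 x0 (dual E)) :=
  AlgDual (eval_box_linear x y e).

Definition lip_tensor := span [set eval_box p.1.1 p.1.2 p.2 | p in [set: X * X * E]].

HB.instance Definition _ := GRing.SubLmodule.on lip_tensor.

Definition box (x y : X) (e : E) : lip_tensor :=
  span_gen (imageP (fun p => eval_box p.1.1 p.1.2 p.2)
                   (I : [set: X * X * E] (x, y, e))).

Definition lip_proj_norm (u : lip_tensor) : R :=
  inf [set r | exists n (x y : 'I_n -> X) (e : 'I_n -> E),
         u = \sum_i box (x i) (y i) (e i) /\
         r = \sum_i mdist (x i) (y i) * rnorm (e i)].

End LipschitzTensorProduct.

Section ProjectiveNorm.
Variables (R : realType) (s : scalars).
Local Notation K := (scalar_field R s).
Variables V W : normedModType K.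

Definition proj_norm (u : tensor_product V W) : R :=
  inf [set r | exists n (v : 'I_n -> V) (w : 'I_n -> W),
         u = \sum_i tens (v i) (w i) /\
         r = \sum_i rnorm (v i) * rnorm (w i)].

End ProjectiveNorm.

(* N plays the role of a norm on V that is not registered as a normedModType:
   it is the Lipschitz projective norm or the projective tensor norm. A
   completion is determined up to isometric isomorphism by this predicate. *)
Definition is_completion (R : realType) (s : scalars)
    (V : lmodType (scalar_field R s)) (N : V -> R)
    (Y : completeNormedModType (scalar_field R s)) (j : {linear V -> Y}) :=
  (forall v, rnorm (j v) = N v) /\ dense (range j).

(* Main.v *)
Require Import Defs.
From HB Require Import structures.
From mathcomp Require Import all_boot all_order all_algebra.
From mathcomp Require Import sesquilinear complex lra ring.
From mathcomp Require Import all_classical all_reals all_analysis.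

Set Implicit Arguments.
Unset Strict Implicit.
Unset Printing Implicit Defensive.
Import Order.TTheory GRing.Theory Num.Theory.
Import numFieldNormedType.Exports.
Local Open Scope classical_set_scope.
Local Open Scope ring_scope.

(** Both projective norms are computed by duality against the same functions.
    A function [f] in Lip_0(X, E') (E' the topological dual of E) gives, on the
    one hand, the functional [u |-> u f] on the Lipschitz tensor product and, on
    the other, the bilinear form [(m, e) |-> m (x |-> f x e)] on F(X) x E, which
    is bounded by [lip f]; on generators both return the value at [e] of
    [f x - f y].

    The map is well defined. Suppose the functionals [box (x i) (y i) (e i)] add
    up to zero. Testing on [f = g *: phi], with [g] scalar Lipschitz and [phi] in
    E', and using that E' separates the points of E (Hahn-Banach), the vectors
    [e i] weighted by [g (x i) - g (y i)] add up to zero in E for every [g].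
    Eliminating the [e i] one at a time turns this into the vanishing of the sum
    of the tensors, see [tens_sum_eq0] and [represents0]. The argument has to be
    algebraic, since a tensor is tested against all bilinear forms, bounded or
    not.

    The map is isometric. It does not increase the norm because the distance of
    two evaluations in F(X) is at most that of the points. For the converse,
    Hahn-Banach yields a functional [L] dominated by the Lipschitz projective
    norm with [L u] equal to the norm of [u]; it is represented by an [f] with
    [lip f <= 1] ([functional_lip0]), and evaluating any representation of the
    image of [u] as a sum of tensors at the bilinear form of [f] bounds the norm
    of [u] by the cost of that representation ([proj_normE]).

    The completions agree because the evaluations span a dense subspace of F(X),
    so that the image is dense in the projective tensor product
    ([dense_embedding]), and because a completion is unique up to isometric
    isomorphism ([completion_unique]). *)

(** * Infima of scaled and added sets *)

Section Infima.
Variable R : realType.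
Implicit Types A B C : set R.

Lemma inf_le_scale (c : R) A B : 0 <= c -> A !=set0 -> has_lbound B ->
  (forall a, A a -> exists2 b, B b & b <= c * a) -> inf B <= c * inf A.
Proof.
move=> c0 A0 lB AB; have infB b : B b -> inf B <= b by exact: ge_inf.
move: c0; rewrite le_eqVlt => /predU1P[c0|c0].
  have [a Aa] := A0; have [b Bb] := AB a Aa.
  by rewrite -c0 !mul0r; apply: le_trans (infB b Bb).
rewrite mulrC -ler_pdivrMr//; apply: lb_le_inf => // a /AB[b Bb ba].
by rewrite ler_pdivrMr// mulrC (le_trans (infB b Bb)).
Qed.

Lemma inf_le_add A B C : A !=set0 -> B !=set0 -> has_lbound C ->
  (forall a b, A a -> B b -> exists2 c, C c & c <= a + b) ->
  inf C <= inf A + inf B.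
Proof.
move=> A0 B0 lC ABC; rewrite -lerBlDr; apply: lb_le_inf => // a Aa.
rewrite lerBlDr -lerBlDl; apply: lb_le_inf => // b Bb.
rewrite lerBlDl; have [c Cc] := ABC a b Aa Bb.
by apply: le_trans; exact: ge_inf.
Qed.

End Infima.

(** * Hahn-Banach *)

Section Sublinear.
Variables (R : realType) (V : lmodType R).
Implicit Types (p q : V -> R) (u v w : V).

Definition sublinear p : Prop :=
  (forall u v, p (u + v) <= p u + p v) /\
  (forall c v, 0 <= c -> p (c *: v) <= c * p v).

Lemma sublinear0 p : sublinear p -> p 0 = 0.
Proof.
move=> [pD pZ]; apply/eqP; rewrite eq_le; apply/andP; split.
  by have := pZ 0 0 (lexx 0); rewrite scaler0 mul0r.
by have := pD 0 0; rewrite addr0 -lerBlDl subrr.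
Qed.

Lemma sublinear_geN p v : sublinear p -> - p (- v) <= p v.
Proof.
move=> sp; have := sp.1 v (- v).
by rewrite subrr sublinear0// -lerBlDr sub0r.
Qed.

Lemma sublinearZ p c v : sublinear p -> 0 <= c -> p (c *: v) = c * p v.
Proof.
move=> sp; rewrite le_eqVlt => /predU1P[<-|c0].
  by rewrite scale0r mul0r sublinear0.
apply/eqP; rewrite eq_le (sp.2 _ _ (ltW c0))/=.
have := sp.2 c^-1 (c *: v); rewrite invr_ge0 => /(_ (ltW c0)).
by rewrite scalerA mulVf ?gt_eqF// scale1r ler_pdivlMl.
Qed.

Lemma sublinear_linear p : sublinear p -> (forall v, p (- v) <= - p v) ->
  linear (p : V -> R^o).
Proof.
move=> sp pN.
have {}pN v : p (- v) = - p v.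
  by apply/eqP; rewrite eq_le pN /= lerNl sublinear_geN.
have pD u v : p (u + v) = p u + p v.
  apply/eqP; rewrite eq_le sp.1 /=.
  by have := sp.1 (- u) (- v); rewrite -opprD !pN -opprD lerN2.
move=> c u v; rewrite pD; congr (_ + _).
have [c0|c0] := leP 0 c; first exact: sublinearZ.
have := sublinearZ u sp (c := - c); rewrite oppr_ge0 ltW// => /(_ isT).
by rewrite scaleNr pN mulNr => /oppr_inj.
Qed.

(** The conditions on [P] say that the values can be added and scaled at no extra
    cost; this covers infima of chains as well as [steepen]. *)
Lemma sublinear_inf (P : V -> set R) :
  (forall v, P v !=set0) -> (forall v, has_lbound (P v)) ->
  (forall u v a b, P u a -> P v b -> exists2 c, P (u + v) c & c <= a + b) ->
  (forall c v a, 0 <= c -> P v a -> exists2 b, P (c *: v) b & b <= c * a) ->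
  sublinear (fun v => inf (P v)).
Proof.
move=> P0 lP PD PZ; split=> [u v|c v c0].
  by apply: inf_le_add => // a b; exact: PD.
by apply: inf_le_scale => // a; exact: PZ.
Qed.

(** [steepen p w] is the largest sublinear functional below [p] that is bounded by
    [- p w] at [- w]; it equals [p] only if [p] is already odd along [w]. *)
Definition steepen_values p w v : set R :=
  [set r | exists2 t, 0 <= t & r = p (v + t *: w) - t * p w].

Definition steepen p w v : R := inf (steepen_values p w v).

Section Steepen.
Variables (p : V -> R) (w : V).
Hypothesis sp : sublinear p.

Lemma steepen_values_lbound v : has_lbound (steepen_values p w v).
Proof.
exists (- p (- v)) => _ [t t0 ->].
rewrite -(sublinearZ _ sp t0) lerBrDl lerBlDr.
by have := sp.1 (v + t *: w) (- v); rewrite addrAC subrr add0r.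
Qed.

Lemma steepen_le_value v t : 0 <= t ->
  steepen p w v <= p (v + t *: w) - t * p w.
Proof. by move=> t0; apply: ge_inf; [exact: steepen_values_lbound|exists t]. Qed.

Lemma steepen_le v : steepen p w v <= p v.
Proof. by have := steepen_le_value v (lexx 0); rewrite scale0r mul0r addr0 subr0. Qed.

Lemma steepenN : steepen p w (- w) <= - p w.
Proof.
have := steepen_le_value (- w) ler01.
by rewrite scale1r mul1r addNr sublinear0// sub0r.
Qed.

Lemma steepen_sublinear : sublinear (steepen p w).
Proof.
apply: sublinear_inf => [v|v|u v _ _ [t t0 ->] [t' t'0 ->]|c v _ c0 [t t0 ->]].
- by exists (p (v + 0 *: w) - 0 * p w); exists 0.
- exact: steepen_values_lbound.
- exists (p (u + v + (t + t') *: w) - (t + t') * p w).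
    by exists (t + t'); rewrite ?addr_ge0.
  by rewrite mulrDl opprD addrACA lerD2r scalerDl addrACA sp.1.
- exists (p (c *: v + (c * t) *: w) - c * t * p w).
    by exists (c * t); rewrite ?mulr_ge0.
  by rewrite -scalerA -scalerDr mulrBr mulrA lerD2r sp.2.
Qed.

End Steepen.

(** Zorn's lemma for the reversed pointwise order. A chain has a finite pointwise
    infimum because every [q] below [p] satisfies [- p (- v) <= q v]. *)
Lemma minimal_sublinear p : sublinear p -> exists q, [/\ sublinear q,
  forall v, q v <= p v &
  forall q', sublinear q' -> (forall v, q' v <= q v) -> q' = q].
Proof.
move=> sp; pose T := {q | sublinear q /\ forall v, q v <= p v}.
pose below (q q' : T) := `[< forall v, sval q' v <= sval q v >].
have [||||[q [sq qp]] qmin] := @Zorn T below.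
- by move=> q; apply/asboolP.
- move=> q q' q'' /asboolP qq' /asboolP qq''.
  by apply/asboolP => v; rewrite (le_trans (qq'' v)).
- move=> [q ?] [q' ?] /asboolP/= qq' /asboolP/= q'q.
  by apply: eq_exist; apply/funext => v; apply/eqP; rewrite eq_le q'q qq'.
- move=> A Atot; have [->|/set0P[q0 Aq0]] := eqVneq A set0.
    by exists (exist _ p (conj sp (fun v => lexx (p v)))).
  have lA v : has_lbound [set sval q v | q in A].
    exists (- p (- v)) => _ [[q [sq qp]] _ <-] /=.
    by rewrite (le_trans _ (sublinear_geN v sq))// lerN2.
  pose m v := inf [set sval q v | q in A].
  have mq (q : T) v : A q -> m v <= sval q v by move=> Aq; apply: ge_inf => //; exists q.
  have sm : sublinear m.
    apply: sublinear_inf => // [v|u v _ _ [q Aq <-] [q' Aq' <-]|c v _ c0 [q Aq <-]].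
    - by exists (sval q0 v); exists q0.
    - have [qq'|q'q] := Atot q q' Aq Aq'.
        exists (sval q' (u + v)); first by exists q'.
        rewrite (le_trans ((svalP q').1.1 u v))// lerD2r.
        by move/asboolP: qq'; exact.
      exists (sval q (u + v)); first by exists q.
      rewrite (le_trans ((svalP q).1.1 u v))// lerD2l.
      by move/asboolP: q'q; exact.
    - exists (sval q (c *: v)); first by exists q.
      exact: (svalP q).1.2.
  have mp v : m v <= p v by rewrite (le_trans (mq q0 v Aq0))// (svalP q0).2.
  by exists (exist _ m (conj sm mp)) => q Aq; apply/asboolP => v; exact: mq.
exists q; split=> // q' sq' q'q.
have q'p v : q' v <= p v by exact: le_trans (qp v).
suff /(congr1 sval) : exist _ q' (conj sq' q'p) = exist _ q (conj sq qp) :> T by [].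
by apply: qmin; apply/asboolP.
Qed.

(** A minimal sublinear functional coincides with all its steepenings, hence is
    odd, hence linear. Starting from [steepen p u] instead of [p] forces the
    value at [u] to be the largest one allowed. *)
Lemma hahn_banach_real p u : sublinear p ->
  exists f : V -> R^o, [/\ linear f, forall v, f v <= p v & f u = p u].
Proof.
move=> sp; have [f [sf fs fmin]] := minimal_sublinear (steepen_sublinear u sp).
have fN v : f (- v) <= - f v.
  rewrite -[in leLHS](fmin _ (steepen_sublinear v sf) (steepen_le v sf)).
  exact: steepenN.
exists f; split=> [|v|]; first exact: sublinear_linear.
  exact: le_trans (fs v) (steepen_le u sp v).
apply/eqP; rewrite eq_le (le_trans (fs u) (steepen_le u sp u))//=.
rewrite (le_trans _ (sublinear_geN u sf))// lerNr.
exact: le_trans (fs _) (steepenN u sp).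
Qed.

End Sublinear.

Section HahnBanach.
Variables (R : realType) (s : scalars).
Local Notation K := (scalar_field R s).

Lemma of_real1 : of_real s (1 : R) = 1.
Proof. by rewrite /of_real; case: s. Qed.

Lemma ltr_of_real (x y : R) : (of_real s x < of_real s y) = (x < y).
Proof. by rewrite !lt_def ler_of_real (can_eq (@of_realK R s)). Qed.

Lemma rnorm_of_real (c : R) : 0 <= c -> rnorm (of_real s c : K^o) = c.
Proof.
move=> c0; rewrite /rnorm ger0_norm ?of_realK//.
by rewrite -(of_real0 R s) ler_of_real.
Qed.

Lemma of_real_le_to_real (k : K) :
  rnorm (k : K^o) <= to_real k -> k = of_real s (to_real k).
Proof.
rewrite /rnorm /of_real /to_real; case: s k => //= -[a b].
rewrite /Normc.normc /= => ba.
have a0 : 0 <= a by rewrite (le_trans _ ba)// sqrtr_ge0.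
have : a ^+ 2 + b ^+ 2 <= a ^+ 2.
  by rewrite -[leLHS]sqr_sqrtr ?addr_ge0 ?sqr_ge0// lerXn2r ?nnegrE ?sqrtr_ge0.
rewrite gerDl => b0; congr (_ +i* _)%C; apply/eqP.
by rewrite -sqrf_eq0 eq_le b0 sqr_ge0.
Qed.

Lemma exists_phase (k : K) : exists2 a : K, rnorm (a : K^o) <= 1 & a * k = `|k|.
Proof.
have [->|k0] := eqVneq k 0.
  by exists 0; rewrite ?mul0r ?normr0// rnorm0.
exists (`|k| / k); last by rewrite mulfVK.
rewrite -(ler_of_real s) of_rnorm of_real1.
rewrite (_ : `|_ : K^o| = `| `|k| / k |)//.
by rewrite normrM normfV normr_id mulfV// normr_eq0.
Qed.

(** An alias, so that restricting scalars to the reals does not compete with the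
    given structure over [K]. *)
Definition realified (V : lmodType K) : Type := V.

Section Realified.
Variable V : lmodType K.

HB.instance Definition _ := GRing.Zmodule.on (realified V).

Definition real_scale (a : R) (v : realified V) : realified V :=
  of_real s a *: (v : V).

Fact real_scaleA a b v : real_scale a (real_scale b v) = real_scale (a * b) v.
Proof. by rewrite /real_scale scalerA of_realM. Qed.

Fact real_scale1 : left_id 1 real_scale.
Proof. by move=> v; rewrite /real_scale of_real1 scale1r. Qed.

Fact real_scaleDr : right_distributive real_scale +%R.
Proof. by move=> a u v; exact: scalerDr. Qed.

Fact real_scaleDl v : {morph real_scale^~ v : a b / a + b}.
Proof. by move=> a b; rewrite /real_scale of_realD scalerDl. Qed.

HB.instance Definition _ := GRing.Zmodule_isLmodule.Build R (realified V)
  real_scaleA real_scale1 real_scaleDr real_scaleDl.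

End Realified.

End HahnBanach.

(** Over the complex numbers the form is [f v - i f (i v)]: replacing [v] by [i v]
    multiplies this value by [i]. *)
Lemma real_part_linear_form (R : realType) (s : scalars)
    (V : lmodType (scalar_field R s)) (f : realified V -> R^o) : linear f ->
  exists2 L : V -> (scalar_field R s)^o, linear L & forall v, to_real (L v) = f v.
Proof.
case: s V f => [V f lf|V f lf]; first by exists f.
have fD u v : f (u + v) = f u + f v by have := lf 1 u v; rewrite !scale1r.
have f0 : f 0 = 0 by apply: (@addrI _ (f 0)); rewrite -fD !addr0.
have fZ (a : R) (v : V) : f (a%:C%C *: v) = a * f v.
  by have := lf a v 0; rewrite !addr0 f0 addr0.
exists (fun v => (f v -i* f ('i%C *: v))%C : R[i]^o) => //= -[a b] u v.
have -> : (a +i* b)%C = a%:C%C + b%:C%C * 'i%C :> R[i].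
  by apply/eqP; rewrite eq_complex /=; apply/andP; split; apply/eqP; ring.
have iE : 'i%C *: ((a%:C%C + b%:C%C * 'i%C) *: u + v) =
    a%:C%C *: ('i%C *: u) + (- b)%:C%C *: u + 'i%C *: v.
  rewrite scalerDr; congr (_ + _); rewrite !scalerA -scalerDl; congr (_ *: _).
  by apply/eqP; rewrite eq_complex /=; apply/andP; split; apply/eqP; ring.
rewrite iE scalerDl -scalerA !fD !fZ.
apply/eqP; rewrite eq_complex /=; apply/andP; split; apply/eqP; ring.
Qed.

(** The real theorem gives the real part of [L]. The bound passes to [L] by
    rotating [v] so that [L v] becomes its own modulus, and [L u] is real because
    its real part is already as large as its modulus may be. *)
Lemma hahn_banach (R : realType) (s : scalars)
    (V : lmodType (scalar_field R s)) (N : V -> R) :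
  (forall u v, N (u + v) <= N u + N v) ->
  (forall a v, N (a *: v) <= rnorm (a : (scalar_field R s)^o) * N v) ->
  forall u, exists L : V -> (scalar_field R s)^o,
    [/\ linear L, forall v, rnorm (L v) <= N v & L u = of_real s (N u)].
Proof.
move=> ND NZ u.
have sN : sublinear (N : realified V -> R).
  split=> [//|c v c0]; rewrite -[c in leRHS](rnorm_of_real s c0).
  exact: NZ.
have [f [/real_part_linear_form[L lL Lf] fN fu]] :=
  hahn_banach_real (u : realified V) sN.
have LN v : rnorm (L v) <= N v.
  have [a a1 aL] := exists_phase (L v).
  have N0 : 0 <= N v.
    have N00 : N 0 = 0 := sublinear0 sN.
    have := ND v (- v); rewrite subrr N00.
    have := NZ (-1) v; rewrite scaleN1r /rnorm normrN1 -of_real1 of_realK mul1r.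
    lra.
  have LZ : L (a *: v) = a *: L v by exact: GRing.scalable_linear.
  rewrite /rnorm (_ : `|L v| = L (a *: v)); last by rewrite LZ -aL.
  rewrite Lf (le_trans (fN _))// (le_trans (NZ _ _))//.
  by rewrite ler_piMl.
exists L; split=> //; rewrite -fu -Lf; apply: of_real_le_to_real.
by rewrite Lf fu LN.
Qed.

(** * Linear maps from graphs and uniqueness of completions *)

(** The maps constructed below are only known through representations or limits
    that involve choices, so they are given as graphs. *)
Lemma linear_of_graph (K : pzRingType) (V W : lmodType K) (T : V -> W -> Prop) :
  (forall u, exists t, T u t) ->
  (forall a u u' t t', T u t -> T u' t' -> T (a *: u + u') (a *: t + t')) ->
  (forall t, T 0 t -> t = 0) ->
  exists f : {linear V -> W}, forall u t, T u t <-> t = f u.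
Proof.
move=> Ttot Tlin T0; have [f fT] := choice Ttot.
have Tuniq u t t' : T u t -> T u t' -> t = t'.
  move=> ut ut'; apply/eqP; rewrite -subr_eq0; apply/eqP/T0.
  by have := Tlin (-1) u u t' t ut' ut; rewrite !scaleN1r addNr addrC.
have lf : linear f by move=> a u v; apply: (Tuniq (a *: u + v)); [|exact: Tlin].
pose F : {linear V -> W} := HB.pack f (GRing.isLinear.Build _ _ _ _ f lf).
by exists F => u t; split=> [ut|->]; [exact: Tuniq (fT u)|exact: fT].
Qed.

Section Completion.
Variable K : numFieldType.

Lemma dense_rangeP (V : Type) (Y : normedModType K) (j : V -> Y) :
  dense (range j) <-> forall y (e : K), 0 < e -> exists v, `|y - j v| < e.
Proof.
split=> [dj y e e0|dj O [y Oy] oO].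
  have [|x [/= yx [v _ vx]]] := dj (ball y e) _ (ball_open y e).
    by exists y; exact: ballxx.
  by exists v; rewrite vx; move: yx; rewrite -ball_normE.
have [e /= e0 eO] := (nbhs_ballP _ _).1 (open_nbhs_nbhs (conj oO Oy)).
have [v yv] := dj y e e0; exists (j v); split; last by exists v.
by apply: eO; rewrite -ball_normE.
Qed.

Section LimitGraph.
Variables (V : lmodType K) (Y Z : normedModType K).
Variables (j : {linear V -> Y}) (k : {linear V -> Z}).

(** The closure of the set of all pairs [(j v, k v)]: the graph of the extension
    by continuity of [j v |-> k v]. Being symmetric in [j] and [k], it also
    yields the inverse map. *)
Definition limit_graph (y : Y) (z : Z) :=
  forall e : K, 0 < e -> exists v, `|y - j v| < e /\ `|z - k v| < e.

Lemma limit_graph_linear a y y' z z' : limit_graph y z -> limit_graph y' z' ->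
  limit_graph (a *: y + y') (a *: z + z').
Proof.
move=> yz yz' e e0.
(* One is added because [a] may vanish. *)
have a0 : 0 < `|a| + 1 by rewrite ltr_wpDl.
have e2 : 0 < e / 2 by rewrite divr_gt0.
have [v [yv zv]] := yz (e / 2 / (`|a| + 1)) (divr_gt0 e2 a0).
have [v' [yv' zv']] := yz' (e / 2) e2.
have close (U : normedModType K) (x x' u u' : U) : `|x - u| < e / 2 / (`|a| + 1) ->
    `|x' - u'| < e / 2 -> `|a *: x + x' - (a *: u + u')| < e.
  move=> xu xu'; rewrite opprD addrACA -scalerBr (le_lt_trans (ler_normD _ _))//.
  rewrite [ltRHS]splitr ler_ltD// normrZ.
  rewrite (le_trans (ler_wpM2l (normr_ge0 a) (ltW xu)))//.
  by rewrite mulrCA ger_pMr// ler_pdivrMr// mul1r lerDl.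
by exists (a *: v + v'); rewrite (linearP j) (linearP k); split; exact: close.
Qed.

Lemma limit_graph_le y z : (forall v, `|k v| = `|j v|) ->
  limit_graph y z -> `|z| <= `|y|.
Proof.
move=> kj yz; apply/ler_addgt0Pr => e e0.
have [v [yv zv]] := yz _ (divr_gt0 e0 (ltr0Sn K 1)).
have close (U : normedModType K) (x u : U) (r : K) : `|x - u| < r ->
    `|x| <= `|u| + r.
  by move=> xu; rewrite -[x in leLHS](subrKC u) (le_trans (ler_normD _ _))// lerD2l ltW.
rewrite (le_trans (close _ _ _ _ zv))// kj [in leRHS](splitr e) addrA lerD2r.
by apply: close; rewrite distrC.
Qed.

End LimitGraph.

Lemma limit_graphC (V : lmodType K) (Y Z : normedModType K)
    (j : {linear V -> Y}) (k : {linear V -> Z}) y z :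
  limit_graph j k y z -> limit_graph k j z y.
Proof. by move=> yz e /yz[v [yv zv]]; exists v. Qed.

Lemma limit_graph_norm (V : lmodType K) (Y Z : normedModType K)
    (j : {linear V -> Y}) (k : {linear V -> Z}) y z :
  (forall v, `|k v| = `|j v|) -> limit_graph j k y z -> `|z| = `|y|.
Proof.
move=> kj yz; apply/eqP; rewrite eq_le (limit_graph_le kj yz) /=.
exact: limit_graph_le (limit_graphC yz).
Qed.

(** The images under [k] of the preimages under [j] of the neighbourhoods of [y]
    form a filter base, Cauchy because [k] and [j] have the same norm; its limit
    is the partner of [y]. *)
Lemma limit_graph_total (V : lmodType K) (Y : normedModType K)
    (Z : completeNormedModType K) (j : {linear V -> Y}) (k : {linear V -> Z}) :
  (forall v, `|k v| = `|j v|) -> dense (range j) ->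
  forall y, exists z, limit_graph j k y z.
Proof.
move=> jk /dense_rangeP dj y.
pose F := filter_from (nbhs y) (fun A => k @` (j @^-1` A)).
have FF : ProperFilter F.
  apply: filter_from_proper.
    apply: filter_from_filter; first by exists setT; exact: filterT.
    move=> A B yA yB; exists (A `&` B); first exact: filterI.
    by move=> _ [v [Av Bv] <-]; split; exists v.
  move=> A /nbhs_ballP[e /= e0 eA]; have [v yv] := dj y e e0.
  by exists (k v), v => //; apply: eA; rewrite -ball_normE.
have cF : cauchy F.
  apply: cauchy_exP => e e0; have e2 : 0 < e / 2 by rewrite divr_gt0.
  have [v yv] := dj y _ e2; exists (k v), (ball y (e / 2)); first exact: nbhsx_ballx.
  move=> _ [w /= yw <-]; move: yw; rewrite -!ball_normE /= => yw.
  rewrite -linearB jk linearB -(subrKA y) [e]splitr.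
  by rewrite (le_lt_trans (ler_normD _ _))// ltrD// distrC.
have Fz : F --> lim F by exact: cauchy_cvg.
set z := lim F in Fz; exists z => e e0.
have [A yA Az] := Fz (ball z e) (nbhsx_ballx z e e0).
have /nbhs_ballP[d /= d0 dAe] : nbhs y (A `&` ball y e).
  by apply: filterI => //; exact: nbhsx_ballx.
have [v yv] := dj y d d0.
have [|Av ev] := dAe (j v); first by rewrite -ball_normE.
exists v; split; first by move: ev; rewrite -ball_normE.
by have := Az (k v); rewrite -ball_normE; apply; exists v.
Qed.

Lemma completion_unique (V : lmodType K) (Y Z : completeNormedModType K)
    (j : {linear V -> Y}) (k : {linear V -> Z}) :
  (forall v, `|k v| = `|j v|) -> dense (range j) -> dense (range k) ->
  exists2 J : {linear Y -> Z}, bijective J & forall y, `|J y| = `|y|.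
Proof.
move=> jk dj dk; have kj v : `|j v| = `|k v| by rewrite jk.
have graphC y z : limit_graph j k y z <-> limit_graph k j z y.
  by split; exact: limit_graphC.
have graph0 (t : Z) : limit_graph j k 0 t -> t = 0.
  by move=> /(limit_graph_norm jk); rewrite normr0; exact: normr0_eq0.
have graph0' (t : Y) : limit_graph k j 0 t -> t = 0.
  by move=> /(limit_graph_norm kj); rewrite normr0; exact: normr0_eq0.
have [J JP] := linear_of_graph (limit_graph_total jk dj)
  (@limit_graph_linear _ _ _ j k) graph0.
have [J' J'P] := linear_of_graph (limit_graph_total kj dk)
  (@limit_graph_linear _ _ _ k j) graph0'.
exists J; last by move=> y; apply: (limit_graph_norm jk); exact/JP.
exists J' => [y|z]; first by apply/esym/J'P/graphC/JP.
by apply/esym/JP/graphC/J'P.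
Qed.

End Completion.

(** * Duality and algebraic tensor products *)

Section Duality.
Variables (R : realType) (s : scalars).
Local Notation K := (scalar_field R s).
Variable E : normedModType K.

Lemma bounded_continuous_form (f : E -> K^o) (C : R) : linear f ->
  (forall e, rnorm (f e) <= C * rnorm e) -> f \in is_continuous_form (E := E).
Proof.
move=> lf fC; apply/asboolP; split=> // e.
pose F : {linear E -> K^o} := HB.pack f (GRing.isLinear.Build _ _ _ _ f lf).
apply: (@bounded_linear_continuous _ _ _ F).
apply/linear_boundedP; exists (of_real s `|C|); split.
  by rewrite ger0_real// -(of_real0 R s) ler_of_real.
move=> r Cr x; rewrite (le_trans (y := of_real s (`|C| * rnorm x)))//.
  rewrite -[leLHS]of_rnorm ler_of_real (le_trans (fC x))//.
  by rewrite ler_wpM2r ?rnorm_ge0 ?ler_norm.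
by rewrite of_realM of_rnorm ler_wpM2r// ltW.
Qed.

Lemma dual_separates (e : E) : (forall phi : dual E, phi e = 0) -> e = 0.
Proof.
move=> e0; have [|a v|L [lL LN Le]] := @hahn_banach R s E (@rnorm R s E) _ _ e.
- exact: rnormD.
- by rewrite rnormZ.
have LC v : rnorm (L v) <= 1 * rnorm v by rewrite mul1r.
have := e0 (Dual (bounded_continuous_form lL LC)).
by rewrite /= Le -(of_real0 R s) => /(can_inj (@of_realK R s))/rnorm_eq0.
Qed.

End Duality.

Section SpanSum.
Variables (K : numFieldType) (V : lmodType K) (S : set V).

Lemma span_sum (u : Defs.span S) : exists n (a : 'I_n -> K) (w : 'I_n -> V)
  (Sw : forall i, S (w i)), u = \sum_i a i *: span_gen (Sw i).
Proof.
case: u => u uS; have /asboolP[n [a [w [Sw uE]]]] := uS.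
by exists n, a, w, Sw; apply: val_inj; rewrite [RHS]raddf_sum.
Qed.

End SpanSum.

Section Tensors.
Variables (K : numFieldType) (V W : lmodType K).
Local Notation VW := (tensor_product V W).
Implicit Types (v : V) (w : W) (t : VW) (B : {bilinear V -> W -> K^o}).

Lemma tensor_ext t t' : (forall B, span_val t B = span_val t' B) -> t = t'.
Proof. by move=> tt'; apply: val_inj; apply/funext. Qed.

Lemma tensorD t t' B : span_val (t + t') B = span_val t B + span_val t' B.
Proof. by []. Qed.

Lemma tensorZ a t B : span_val (a *: t) B = a *: span_val t B.
Proof. by []. Qed.

Lemma tensor_sumE n (t : 'I_n -> VW) B :
  span_val (\sum_i t i) B = \sum_i span_val (t i) B.
Proof. by elim/big_rec2: _ => // i y x _ <-. Qed.

Lemma tensDl v v' w : tens (v + v') w = tens v w + tens v' w.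
Proof. by apply: tensor_ext => B; rewrite tensorD /= /eval_bilin linearDl. Qed.

Lemma tensZl a v w : tens (a *: v) w = a *: tens v w.
Proof. by apply: tensor_ext => B; rewrite tensorZ /= /eval_bilin linearZl_LR. Qed.

Lemma tensZr a v w : tens v (a *: w) = a *: tens v w.
Proof. by apply: tensor_ext => B; rewrite tensorZ /= /eval_bilin linearZr_LR. Qed.

Lemma tens0l w : tens (0 : V) w = 0.
Proof. by have := tensZl 0 (0 : V) w; rewrite !scale0r. Qed.

Lemma tensBl v v' w : tens (v - v') w = tens v w - tens v' w.
Proof. by rewrite -[- v']scaleN1r tensDl tensZl scaleN1r. Qed.

Lemma tens_suml n (v : 'I_n -> V) w : tens (\sum_i v i) w = \sum_i tens (v i) w.
Proof.
apply: tensor_ext => B; rewrite tensor_sumE /= /eval_bilin.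
by rewrite -[LHS]/(applyr B w _) raddf_sum.
Qed.

Lemma tens_sumr n v (w : 'I_n -> W) : tens v (\sum_i w i) = \sum_i tens v (w i).
Proof.
by apply: tensor_ext => B; rewrite tensor_sumE /= /eval_bilin raddf_sum.
Qed.

Lemma tensor_sum t : exists n (v : 'I_n -> V) (w : 'I_n -> W),
  t = \sum_i tens (v i) (w i).
Proof.
have [n [a [w [Sw ->]]]] := span_sum t.
have /choice[p pP] i : exists p : V * W, eval_bilin p.1 p.2 = w i.
  by have [p _ <-] := Sw i; exists p.
exists n, (fun i => a i *: (p i).1), (fun i => (p i).2).
apply: eq_bigr => i _; rewrite tensZl; congr (_ *: _).
by apply: val_inj; rewrite /= pP.
Qed.

(** Induction on the number of terms. If [w ord0] is a combination of the other
    [w i], it is substituted and the number of terms drops; otherwise the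
    relations force every [ev g (v ord0)], hence [v ord0], to vanish. *)
Lemma tens_sum_eq0 (G : Type) (ev : G -> V -> K^o) :
  (forall g, linear (ev g)) -> (forall v, (forall g, ev g v = 0) -> v = 0) ->
  forall n (v : 'I_n -> V) (w : 'I_n -> W),
  (forall g, \sum_i ev g (v i) *: w i = 0) -> \sum_i tens (v i) (w i) = 0.
Proof.
move=> lev sep; elim=> [|n IHn] v w vw0; first by rewrite big_ord0.
pose v' i := v (lift ord0 i); pose w' i := w (lift ord0 i).
have [[c w0E]|indep] := pselect (exists c : 'I_n -> K, w ord0 = \sum_i c i *: w' i).
  have -> : \sum_i tens (v i) (w i) = \sum_i tens (v' i + c i *: v ord0) (w' i).
    rewrite big_ord_recl w0E tens_sumr -big_split /=; apply: eq_bigr => i _.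
    by rewrite tensDl tensZl tensZr addrC.
  apply: IHn => g; rewrite -[RHS](vw0 g) big_ord_recl w0E scaler_sumr -big_split.
  apply: eq_bigr => i _.
  by rewrite /= addrC (addrC (v' i)) lev scalerDl addrC scalerA mulrC.
have v0 : v ord0 = 0.
  apply: sep => g; apply/eqP; apply: contra_notT indep => g0.
  exists (fun i => - (ev g (v ord0))^-1 * ev g (v' i)).
  have := vw0 g; rewrite big_ord_recl => /eqP; rewrite addr_eq0 => /eqP evw.
  rewrite -[LHS]scale1r -(mulVf g0) -scalerA evw scalerN -scaleNr scaler_sumr.
  by apply: eq_bigr => i _; rewrite scalerA.
rewrite big_ord_recl v0 tens0l add0r; apply: IHn => g.
have := vw0 g; rewrite big_ord_recl v0.
have ev0 : ev g (0 *: 0) = 0 *: ev g 0 := GRing.scalable_linear (lev g) 0 0.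
move: ev0; rewrite !scale0r => ->; by rewrite scale0r add0r.
Qed.

End Tensors.

(** The following rules hold by computation; stating them for abstract spaces keeps
    that computation away from the concrete spaces of functions. *)
Section SpanVal.
Variables (K : numFieldType) (V : lmodType K) (S : set V).
Implicit Types u v : Defs.span S.

Lemma span_valD u v : span_val (u + v) = span_val u + span_val v.
Proof. by []. Qed.

Lemma span_val0 : span_val (0 : Defs.span S) = 0.
Proof. by []. Qed.

Lemma span_valZ a u : span_val (a *: u) = a *: span_val u.
Proof. by []. Qed.

End SpanVal.

Section AlgDual.
Variables (K : numFieldType) (V : lmodType K).
Implicit Types f g : alg_dual V.

Lemma alg_dualD f g v : (f + g) v = f v + g v.
Proof. by []. Qed.

Lemma alg_dual0 v : (0 : alg_dual V) v = 0.
Proof. by []. Qed.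

Lemma alg_dualZ a f v : (a *: f) v = a *: f v.
Proof. by []. Qed.

End AlgDual.

(** * Representations of elements of the Lipschitz tensor product *)

Section BoxRepresentations.
Variables (R : realType) (s : scalars) (X : metricType R) (x0 : X).
Local Notation K := (scalar_field R s).
Variable E : normedModType K.
Local Notation XE := (lip_tensor x0 E).
Local Notation FE := (tensor_product (free_space s x0) E).
Implicit Types (u : XE) (t : FE) (f : lip0 x0 (dual E)) (x y : X) (e : E).

Lemma box_ext u u' : (forall f, span_val u f = span_val u' f) -> u = u'.
Proof. by move=> uu'; apply/val_inj/val_inj/funext. Qed.

Lemma boxDE u u' f : span_val (u + u') f = span_val u f + span_val u' f.
Proof. by rewrite span_valD alg_dualD. Qed.

Lemma boxZE a u f : span_val (a *: u) f = a *: span_val u f.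
Proof. by rewrite span_valZ alg_dualZ. Qed.

Lemma box0E f : span_val (0 : XE) f = 0.
Proof. by rewrite span_val0 alg_dual0. Qed.

Lemma box_sumE n (u : 'I_n -> XE) f :
  span_val (\sum_i u i) f = \sum_i span_val (u i) f.
Proof.
elim/big_rec2: _ => [|i v w _ <-]; first exact: box0E.
exact: boxDE.
Qed.

Lemma boxE x y e f : span_val (box x0 x y e) f = (f x - f y : dual E) e.
Proof. by []. Qed.

Lemma boxDr x y e e' : box x0 x y (e + e') = box x0 x y e + box x0 x y e'.
Proof.
apply: box_ext => f; rewrite boxDE !boxE; have := dual_linear (f x - f y) 1 e e'.
by rewrite !scale1r.
Qed.

Lemma boxZr a x y e : box x0 x y (a *: e) = a *: box x0 x y e.
Proof.
apply: box_ext => f; rewrite boxZE !boxE.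
exact: (GRing.scalable_linear (@dual_linear _ _ _ (f x - f y))).
Qed.

Lemma boxB x y e : box x0 x y e = box x0 x x0 e - box x0 y x0 e.
Proof.
apply: box_ext => f; rewrite -scaleN1r boxDE boxZE !boxE !dualE !lip0_base.
rewrite scaleN1r (_ : (0 : dual E) e = 0)//.
by rewrite oppr0 !addr0.
Qed.

Lemma box_diag x e : box x0 x x e = 0.
Proof. by rewrite boxB subrr. Qed.

Lemma box_sum u : exists n (x y : 'I_n -> X) (e : 'I_n -> E),
  u = \sum_i box x0 (x i) (y i) (e i).
Proof.
have [n [a [w [Sw ->]]]] := span_sum u.
have /choice[p pP] i : exists p : X * X * E,
    eval_box x0 p.1.1 p.1.2 p.2 = w i.
  by have [p _ <-] := Sw i; exists p.
exists n, (fun i => (p i).1.1), (fun i => (p i).1.2), (fun i => a i *: (p i).2).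
apply: eq_bigr => i _; rewrite boxZr; congr (_ *: _).
by apply: val_inj; rewrite /= pP.
Qed.

(** [u], its image [t] and the cost [r] read off from one common family of points
    and vectors, so that sums and multiples of representations are treated once
    for the well-definedness of the map and for both norm estimates. *)
Definition represents u t (r : R) := exists n (x y : 'I_n -> X) (e : 'I_n -> E),
  [/\ u = \sum_i box x0 (x i) (y i) (e i),
      t = \sum_i tens (free_delta s x0 (x i) - free_delta s x0 (y i)) (e i) &
      r = \sum_i mdist (x i) (y i) * rnorm (e i)].

Lemma represents_box x y e : represents (box x0 x y e)
  (tens (free_delta s x0 x - free_delta s x0 y) e) (mdist x y * rnorm e).
Proof. by exists 1%N, (fun=> x), (fun=> y), (fun=> e); split; rewrite big_ord1. Qed.

Lemma represents_total u : exists t r, represents u t r.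
Proof.
have [n [x [y [e uE]]]] := box_sum u.
by do 2 eexists; exists n, x, y, e; split.
Qed.

Lemma representsD u u' t t' r r' : represents u t r -> represents u' t' r' ->
  represents (u + u') (t + t') (r + r').
Proof.
move=> [n [x [y [e [-> -> ->]]]]] [m [x' [y' [e' [-> -> ->]]]]].
pose cat A (a : 'I_n -> A) (b : 'I_m -> A) (i : 'I_(n + m)) :=
  match fintype.split i with inl j => a j | inr j => b j end.
have catl A (a : 'I_n -> A) b j : cat A a b (lshift m j) = a j.
  by rewrite /cat (unsplitK (inl j)).
have catr A (a : 'I_n -> A) b j : cat A a b (rshift n j) = b j.
  by rewrite /cat (unsplitK (inr j)).
exists (n + m)%N, (cat X x x'), (cat X y y'), (cat E e e').
by split; rewrite big_split_ord; congr (_ + _); apply: eq_bigr => i _;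
  rewrite ?catl ?catr.
Qed.

Lemma representsZ a u t r : represents u t r ->
  represents (a *: u) (a *: t) (rnorm (a : K^o) * r).
Proof.
move=> [n [x [y [e [-> -> ->]]]]]; exists n, x, y, (fun i => a *: e i).
split; [rewrite scaler_sumr|rewrite scaler_sumr|rewrite mulr_sumr];
  apply: eq_bigr => i _.
- by rewrite boxZr.
- by rewrite tensZr.
- by rewrite rnormZ mulrCA.
Qed.

Definition rank_one (phi : dual E) (g : lip0 x0 K^o) (x : X) : dual E := g x *: phi.

Lemma rank_one_lip0 phi g : rank_one phi g \in is_lip0 x0 (F := dual E).
Proof.
apply/asboolP; split; first by rewrite /rank_one lip0_base scale0r.
exists (lip g * rnorm phi) => x y.
by rewrite -scalerBl rnormZ mulrAC ler_wpM2r ?rnorm_ge0 ?lipP.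
Qed.

Lemma free_ext (m : free_space s x0) : (forall g, free_val m g = 0) -> m = 0.
Proof. by move=> m0; apply/val_inj/val_inj/funext. Qed.

(** Well-definedness: testing the vanishing sum on the functions [rank_one phi g]
    for all [phi] shows, as the dual separates points, that the weighted sum of
    the [e i] vanishes for every [g], which is what [tens_sum_eq0] requires. *)
Lemma represents0 t r : represents 0 t r -> t = 0.
Proof.
move=> [n [x [y [e [u0 -> _]]]]].
apply: (tens_sum_eq0 (ev := fun g m => free_val m g)) => [//||g].
  exact: free_ext.
apply: dual_separates => phi.
pose phiL : {linear E -> K^o} :=
  HB.pack (phi : E -> K^o) (GRing.isLinear.Build _ _ _ _ phi (@dual_linear _ _ _ phi)).
rewrite -[LHS]/(phiL _) raddf_sum.
have := congr1 (fun u => span_val u (Lip0 (rank_one_lip0 phi g))) u0.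
rewrite /= box_sumE => h; rewrite [RHS]h; apply: eq_bigr => i _.
rewrite boxE /= /rank_one -scalerBl.
exact: (GRing.scalable_linear (@dual_linear _ _ _ phi)).
Qed.

End BoxRepresentations.

(** * Lipschitz functions as bounded bilinear forms *)

Section LipschitzBilinear.
Variables (R : realType) (s : scalars) (X : metricType R) (x0 : X).
Local Notation K := (scalar_field R s).
Variable E : normedModType K.
Variable f : lip0 x0 (dual E).

Lemma slice_lipschitz e x y :
  rnorm (f x e - f y e) <= lip f * rnorm e * mdist x y.
Proof.
rewrite -[f x e - f y e]/((f x - f y : dual E) e).
rewrite (le_trans (dual_normP _ _))// mulrAC ler_wpM2r ?rnorm_ge0//.
by rewrite -rnorm_dualE lipP.
Qed.

Fact slice_lip0 e : (fun x => f x e) \in is_lip0 x0 (F := K^o).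
Proof.
apply/asboolP; split; first by rewrite lip0_base.
by exists (lip f * rnorm e) => x y; exact: slice_lipschitz.
Qed.

Definition slice e : lip0 x0 K^o := Lip0 (slice_lip0 e).

Lemma slice_linear : linear slice.
Proof. by move=> a e e'; apply/val_inj/funext => x; exact: dual_linear. Qed.

Lemma lip_slice e : lip (slice e) <= lip f * rnorm e.
Proof.
apply: least_constant_le; split=> [|[x y] /=].
  by rewrite mulr_ge0 ?lip_ge0 ?rnorm_ge0.
exact: slice_lipschitz.
Qed.

Definition lip_pairing (m : free_space s x0) (e : E) : K^o := free_val m (slice e).

Lemma lip_pairing_bilinear : bilinear_for
  (GRing.Scale.Law.clone _ _ *:%R _) (GRing.Scale.Law.clone _ _ *:%R _) lip_pairing.
Proof.
split=> [e a m n //|m a e e'].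
by rewrite /lip_pairing slice_linear dual_linear.
Qed.

HB.instance Definition _ := bilinear_isBilinear.Build K (free_space s x0) E K^o
  _ _ lip_pairing lip_pairing_bilinear.

Lemma lip_pairing_le m e : rnorm (lip_pairing m e) <= lip f * (rnorm m * rnorm e).
Proof.
rewrite (le_trans (dual_normP _ _))// -rnorm_dualE mulrCA.
by rewrite ler_wpM2l ?rnorm_ge0// rnorm_lip0E lip_slice.
Qed.

Lemma lip_pairing_delta x y e :
  lip_pairing (free_delta s x0 x - free_delta s x0 y) e = (f x - f y : dual E) e.
Proof. by []. Qed.

Lemma represents_eval u t r : represents u t r ->
  span_val u f = span_val t lip_pairing.
Proof.
move=> [n [x [y [e [-> -> _]]]]]; rewrite box_sumE tensor_sumE.
by apply: eq_bigr => i _; rewrite boxE -lip_pairing_delta.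
Qed.

End LipschitzBilinear.

(** * The isometric embedding *)

Section Isometry.
Variables (R : realType) (s : scalars) (X : metricType R) (x0 : X).
Local Notation K := (scalar_field R s).
Variable E : normedModType K.
Local Notation XE := (lip_tensor x0 E).
Local Notation FE := (tensor_product (free_space s x0) E).
Implicit Types (u : XE) (t : FE) (x y : X) (e : E).

Definition image_of u t := exists r, represents u t r.

Lemma tensor_embedding :
  exists I : {linear XE -> FE}, forall u t, image_of u t <-> t = I u.
Proof.
apply: linear_of_graph => [u|a u u' t t' [r ut] [r' ut']|t [r]].
- exact: represents_total.
- by eexists; apply: representsD ut'; exact: representsZ ut.
- exact: represents0.
Qed.

Lemma represents_uniq u t t' r r' :
  represents u t r -> represents u t' r' -> t = t'.
Proof.
move=> ut ut'; have [I IP] := tensor_embedding.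
by rewrite ((IP u t).1 (ex_intro _ r ut)) ((IP u t').1 (ex_intro _ r' ut')).
Qed.

Definition costs u : set R := [set r | exists t, represents u t r].

Lemma costs_neq0 u : costs u !=set0.
Proof. by have [t [r utr]] := represents_total u; exists r, t. Qed.

Lemma costs_ge0 u r : costs u r -> 0 <= r.
Proof.
move=> [t [n [x [y [e [_ _ ->]]]]]]; apply: sumr_ge0 => i _.
by rewrite mulr_ge0 ?mdist_ge0 ?rnorm_ge0.
Qed.

Lemma lip_proj_normE u : lip_proj_norm u = inf (costs u).
Proof.
congr inf; apply/seteqP; split=> r.
  by move=> [n [x [y [e [uE rE]]]]]; eexists; exists n, x, y, e; split.
by move=> [t [n [x [y [e [uE _ rE]]]]]]; exists n, x, y, e.
Qed.

Lemma lip_proj_norm_le u r : costs u r -> lip_proj_norm u <= r.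
Proof.
by rewrite lip_proj_normE => ur; apply: ge_inf => //; exists 0 => ? /costs_ge0.
Qed.

Lemma lip_proj_normD u u' :
  lip_proj_norm (u + u') <= lip_proj_norm u + lip_proj_norm u'.
Proof.
rewrite !lip_proj_normE; apply: inf_le_add; try exact: costs_neq0.
  by exists 0 => ? /costs_ge0.
move=> r r' [t utr] [t' utr']; exists (r + r') => //.
by exists (t + t'); exact: representsD.
Qed.

Lemma lip_proj_normZ (a : K) u :
  lip_proj_norm (a *: u) <= rnorm (a : K^o) * lip_proj_norm u.
Proof.
rewrite !lip_proj_normE; apply: inf_le_scale; rewrite ?rnorm_ge0//.
- exact: costs_neq0.
- by exists 0 => ? /costs_ge0.
move=> r [t utr]; exists (rnorm (a : K^o) * r) => //.
by exists (a *: t); exact: representsZ.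
Qed.

Section Functional.
Variable L : XE -> K^o.
Hypotheses (lL : linear L) (LN : forall u, rnorm (L u) <= lip_proj_norm u).

Let LL : {linear XE -> K^o} := HB.pack L (GRing.isLinear.Build _ _ _ _ L lL).

Let L_box x y e : rnorm (L (box x0 x y e)) <= mdist x y * rnorm e.
Proof.
rewrite (le_trans (LN _))//; apply: lip_proj_norm_le.
by eexists; exact: represents_box.
Qed.

Let box_linear x y : linear (box x0 x y : E -> XE).
Proof. by move=> a e e'; rewrite boxDr boxZr. Qed.

Let L_form x : (fun e => L (box x0 x x0 e)) \in is_continuous_form (E := E).
Proof.
apply: (bounded_continuous_form (C := mdist x x0)); last exact: L_box.
by move=> a e e'; rewrite box_linear lL.
Qed.

Let L_fun x : dual E := Dual (L_form x).

Let L_funB x y e : (L_fun x - L_fun y) e = L (box x0 x y e).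
Proof. by rewrite boxB -[RHS]/(LL _) raddfB. Qed.

Let L_fun_le x y : rnorm (L_fun x - L_fun y) <= 1 * mdist x y.
Proof.
rewrite mul1r rnorm_dualE; apply: least_constant_le; split=> [|e].
  exact: mdist_ge0.
by rewrite L_funB.
Qed.

Let L_lip0 : L_fun \in is_lip0 x0 (F := dual E).
Proof.
apply/asboolP; split; last by exists 1; exact: L_fun_le.
apply/val_inj/funext => e /=.
by rewrite box_diag -[LHS]/(LL _) raddf0.
Qed.

(** Lip_0(X, E') is the dual of the Lipschitz tensor product: the function is
    [x |-> (e |-> L (box x x0 e))], and its increments are the values of [L] on
    [box x y e], whose norm is at most [mdist x y * rnorm e]. *)
Lemma functional_lip0 : exists f : lip0 x0 (dual E),
  lip f <= 1 /\ forall u, span_val u f = L u.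
Proof.
exists (Lip0 L_lip0); split.
  by apply: least_constant_le; split=> // -[x y]; exact: L_fun_le.
move=> u; have [n [x [y [e ->]]]] := box_sum u.
rewrite box_sumE -[RHS]/(LL _) raddf_sum; apply: eq_bigr => i _.
exact: L_funB.
Qed.

End Functional.

Lemma rnorm_freeE (m : free_space s x0) : rnorm m = dual_norm (free_val m).
Proof. exact: rnorm_dualE. Qed.

Lemma rnorm_free_deltaB x y :
  rnorm (free_delta s x0 x - free_delta s x0 y) <= mdist x y.
Proof.
rewrite rnorm_freeE; apply: least_constant_le; split=> [|g]; first exact: mdist_ge0.
by rewrite rnorm_lip0E mulrC; exact: lipP.
Qed.

Lemma proj_norm_le u t r : represents u t r -> proj_norm t <= r.
Proof.
move=> [n [x [y [e [_ -> ->]]]]].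
apply: (@le_trans _ _ (\sum_i
    rnorm (free_delta s x0 (x i) - free_delta s x0 (y i)) * rnorm (e i))).
  apply: ge_inf; last by do 3 eexists; split.
  exists 0 => _ [m [v [w [_ ->]]]]; apply: sumr_ge0 => i _.
  by rewrite mulr_ge0 ?rnorm_ge0.
by apply: ler_sum => i _; rewrite ler_wpM2r ?rnorm_ge0 ?rnorm_free_deltaB.
Qed.

(** The left factors of a representation of [t] by tensors lie in the closed span
    of the evaluations, so its cost cannot be compared with that of a
    representation of [u] term by term; the functional [L] norming [u] compares
    them through its value. *)
Lemma proj_normE u t r : represents u t r -> proj_norm t = lip_proj_norm u.
Proof.
move=> utr; apply/eqP; rewrite eq_le; apply/andP; split.
  rewrite lip_proj_normE; apply: lb_le_inf; first exact: costs_neq0.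
  move=> r' [t' ut']; rewrite -(represents_uniq ut' utr).
  exact: proj_norm_le ut'.
have [n [v [w tE]]] := tensor_sum t.
apply: lb_le_inf; first by do 2 eexists; exists v, w; split.
move=> _ [{tE}{}n [{}v [{}w [tE ->]]]].
have [L [lL LN Lu]] := hahn_banach lip_proj_normD lip_proj_normZ u.
have [f [f1 fL]] := functional_lip0 lL LN.
have N0 : 0 <= lip_proj_norm u.
  by rewrite lip_proj_normE; apply: lb_le_inf; [exact: costs_neq0|exact: costs_ge0].
rewrite -(rnorm_of_real s N0) -Lu -fL (represents_eval f utr) tE tensor_sumE.
apply: (@le_trans _ _ (\sum_i rnorm (lip_pairing f (v i) (w i)))).
  elim/big_rec2: _ => [|i a b _ ab]; first by rewrite rnorm0.
  by rewrite (le_trans (rnormD _ _))// lerD2l.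
apply: ler_sum => i _; rewrite (le_trans (lip_pairing_le _ _ _))//.
by rewrite ler_piMl// mulr_ge0 ?rnorm_ge0.
Qed.

Lemma proj_norm_tens (v : free_space s x0) e :
  proj_norm (tens v e) <= rnorm v * rnorm e.
Proof.
apply: ge_inf.
  exists 0 => _ [m [v' [w [_ ->]]]]; apply: sumr_ge0 => i _.
  by rewrite mulr_ge0 ?rnorm_ge0.
by exists 1%N, (fun=> v), (fun=> e); rewrite !big_ord1.
Qed.

(** This makes [delta x] a difference of evaluations, as in the image of [box]. *)
Lemma free_delta_base : free_delta s x0 x0 = 0.
Proof. by apply: free_ext => g; exact: lip0_base. Qed.

Lemma free_delta_dense (m : free_space s x0) (d : R) : 0 < d ->
  exists n (a : 'I_n -> K) (x : 'I_n -> X),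
    rnorm (m - \sum_i a i *: free_delta s x0 (x i)) < d.
Proof.
move=> d0.
have kd0 : 0 < of_real s d by rewrite -(of_real0 R s) ltr_of_real.
have [_ /asboolP[n [a [w [Sw ->]]]] mw] := in_freeP _ (valP m) _ kd0.
have /choice[x xw] i : exists x, delta s x0 x = w i.
  by have [x _ <-] := Sw i; exists x.
exists n, a, x; rewrite -(ltr_of_real s) of_rnorm normr_freeE.
suff -> : free_val (m - \sum_i a i *: free_delta s x0 (x i)) =
  free_val m - \sum_i a i *: w i by [].
rewrite -[LHS]/(\val _) raddfB raddf_sum; congr (_ - _).
by apply: eq_bigr => i _; rewrite -xw.
Qed.

(** * Density of the image *)

Section Density.
Variables (I : {linear XE -> FE}) (Z : normedModType K) (k : {linear FE -> Z}).
Hypotheses (IP : forall u t, image_of u t <-> t = I u).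
Hypotheses (kN : forall t, rnorm (k t) = proj_norm t) (kd : dense (range k)).

Definition near_range t :=
  forall d : R, 0 < d -> exists u, rnorm (k t - k (I u)) < d.

Lemma near_range_tens v e : near_range (tens v e).
Proof.
move=> d d0.
(* One is added because [e] may vanish. *)
have e1 : 0 < rnorm e + 1 by rewrite ltr_wpDl ?rnorm_ge0.
have [n [a [x vx]]] := free_delta_dense v (divr_gt0 d0 e1).
exists (\sum_i box x0 (x i) x0 (a i *: e)).
have -> : I (\sum_i box x0 (x i) x0 (a i *: e)) =
    tens (\sum_i a i *: free_delta s x0 (x i)) e.
  rewrite raddf_sum tens_suml; apply: eq_bigr => i _; rewrite tensZl -tensZr.
  rewrite -[X in tens X]subr0 -free_delta_base.
  by apply/esym/IP; eexists; exact: represents_box.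
rewrite -raddfB -tensBl kN (le_lt_trans (proj_norm_tens _ _))//.
have [->|eN0] := eqVneq (rnorm e) 0; first by rewrite mulr0.
have e0 : 0 < rnorm e by rewrite lt_def eN0 rnorm_ge0.
rewrite (lt_le_trans (y := d / (rnorm e + 1) * rnorm e)) ?ltr_pM2r//.
by rewrite -mulrA ger_pMr// ler_pdivrMl// mulr1 lerDl.
Qed.

Lemma near_range_all t : near_range t.
Proof.
have [n [v [w ->]]] := tensor_sum t.
elim/big_ind: _ => [d d0|t1 t2 t1d t2d d d0|i _]; last exact: near_range_tens.
  by exists 0; rewrite !raddf0 addr0 rnorm0.
have [u1 u1d] := t1d _ (divr_gt0 d0 (ltr0Sn R 1)).
have [u2 u2d] := t2d _ (divr_gt0 d0 (ltr0Sn R 1)).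
exists (u1 + u2); rewrite (raddfD I) !(raddfD k) opprD addrACA (le_lt_trans (rnormD _ _))//.
by rewrite [ltRHS]splitr ltrD.
Qed.

Lemma dense_embedding : dense (range (k \o I)).
Proof.
apply/dense_rangeP => z d d0; have d2 : 0 < d / 2 by rewrite divr_gt0.
have [t zt] := (dense_rangeP k).1 kd z _ d2.
have r2 : 0 < to_real (d / 2).
  by rewrite -(ltr_of_real s) of_real0 to_realK// ltW.
have [u tu] := near_range_all t r2.
exists u; rewrite -(subrKA (k t)) [ltRHS]splitr (le_lt_trans (ler_normD _ _))//.
by rewrite ltrD// -of_rnorm -[ltRHS](@to_realK R s) ?ltW// ltr_of_real.
Qed.

End Density.

End Isometry.

Theorem proposition6p8 (R : realType) (s : scalars) (X : metricType R) (x0 : X)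
    (E : completeNormedModType (scalar_field R s)) :
  (exists I : {linear lip_tensor x0 E -> tensor_product (free_space s x0) E},
    (forall n (x y : 'I_n -> X) (e : 'I_n -> E),
      I (\sum_i box x0 (x i) (y i) (e i)) =
      \sum_i tens (free_delta s x0 (x i) - free_delta s x0 (y i)) (e i)) /\
    (forall u, proj_norm (I u) = lip_proj_norm u)) /\
  (forall (Y Z : completeNormedModType (scalar_field R s))
      (j : {linear lip_tensor x0 E -> Y})
      (k : {linear tensor_product (free_space s x0) E -> Z}),
    is_completion (@lip_proj_norm R s X x0 E) j ->
    is_completion (@proj_norm R s (free_space s x0) E) k ->
    exists2 J : {linear Y -> Z}, bijective J & forall y, `|J y| = `|y|).
Proof.
have [I IP] := tensor_embedding x0 E.
have I_isometry u : proj_norm (I u) = lip_proj_norm u.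
  by have [r uIu] := (IP u (I u)).2 erefl; exact: proj_normE uIu.
split.
  exists I; split=> // n x y e; apply/esym/IP.
  by eexists; exists n, x, y, e; split.
move=> Y Z j k [jN dj] [kN dk].
apply: (completion_unique (j := j) (k := k \o I)) => //.
  by move=> u; rewrite /= -!of_rnorm kN jN I_isometry.
exact: dense_embedding IP kN dk.
Qed.
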